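(* Let $m\ge 1$ be an odd integer and let $i\ge 3$ be an integer. Then, as formal power series in $\mathbb{Z}[[q]]$, $$\sum_{n\ge 0}\Bigl(\overline{\mathrm{OPT}}_m\bigl(2^i n\bigr)-\overline{\mathrm{OPT}}_m\bigl(2^{i-1}n\bigr)\Bigr)q^n\equiv 2^{\,i+1}\sum_{k\ge 0}q^{(2k+1)^2}\pmod{2^{\,i+2}},$$ where the congruence is coefficientwise.
   Context: An overpartition of $n$ is a partition of $n$ in which the first occurrence of each part may be overlined. For an integer $m\ge 1$, $\overline{\mathrm{OPT}}_m(n)$ denotes the number of overpartition $m$-tuples of $n$ into odd parts, i.e. $m$-tuples of overpartitions all of whose parts are odd and whose parts sum (over all components) to $n$. Equivalently, $$\sum_{n\ge 0}\overline{\mathrm{OPT}}_m(n)q^n=\prod_{j\ge 1,\ j\text{ odd}}\left(\frac{1+q^j}{1-q^j}\right)^m\in\mathbb{Z}[[q]].$$ *)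

(* Defs.v *)
From mathcomp Require Import all_boot all_order all_algebra.

Set Implicit Arguments.
Unset Strict Implicit.
Unset Printing Implicit Defensive.

(* A part is a pair (size, overlined?).  Since the sizes are non-increasing,
   equal parts are adjacent, and a part is a first occurrence iff it is not
   preceded by an equal one. *)
Definition next_part (x y : nat * bool) : bool :=
  (y.1 <= x.1) && ((y.1 == x.1) ==> ~~ y.2).

Definition overpartition (s : seq (nat * bool)) : bool :=
  all (leq 1) (unzip1 s) && sorted next_part s.

Definition odd_parts (s : seq (nat * bool)) : bool := all odd (unzip1 s).

Definition weight (s : seq (nat * bool)) : nat := sumn (unzip1 s).

(* Sequences of at most n parts, each of size at most n: a finite type, large
   enough for all overpartitions of weight at most n (see
   overpartition_bounded). *)
Definition bounded_parts (n : nat) : finType := n.-bseq ('I_n.+1 * bool)%type.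

Definition parts_of (n : nat) (s : bounded_parts n) : seq (nat * bool) :=
  [seq (val x.1, x.2) | x <- bseqval s].

Lemma overpartition_bounded (n : nat) (s : seq (nat * bool)) :
  overpartition s -> weight s <= n -> exists t : bounded_parts n, parts_of t = s.
Proof.
case/andP=> pos_s _ le_sn.
have le_part x : x \in s -> x.1 <= n.
  move=> xs; apply: leq_trans le_sn; rewrite /weight.
  have: x.1 \in unzip1 s by apply: map_f.
  elim: (unzip1 s) => //= a l IHl; rewrite inE => /orP[/eqP->|/IHl le_xl].
    exact: leq_addr.
  exact: leq_trans le_xl (leq_addl _ _).
have le_size : size [seq (inord x.1 : 'I_n.+1, x.2) | x <- s] <= n.
  rewrite size_map; apply: leq_trans le_sn.
  rewrite -(size_map fst s) -/(unzip1 s) /weight; move: pos_s.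
  by elim: (unzip1 s) => //= a l IHl /andP[a0 /IHl le_l]; rewrite -add1n leq_add.
exists (Bseq le_size); rewrite /parts_of /= -map_comp.
rewrite -[RHS]map_id; apply/eq_in_map => -[a b] xs /=.
by rewrite inordK // ltnS (le_part _ xs).
Qed.

Definition OPT (m n : nat) : nat :=
  #|[set t : m.-tuple (bounded_parts n) |
      all (fun s => overpartition (parts_of s) && odd_parts (parts_of s)) t
      && (\sum_(s <- t) weight (parts_of s) == n)]|.

(* The coefficient of q^n in \sum_(k >= 0) q^((2k+1)^2); only k <= n can
   contribute to it, as k < (2k+1)^2. *)
Definition odd_square_coef (n : nat) : int :=
  Posz (\sum_(k < n.+1) ((2 * k + 1) ^ 2 == n)).

(* Main.v *)
(* Let P = sum OPT_1(n) q^n, so that P^m generates OPT_m, and let U map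
   sum a(n) q^n to sum a(2n) q^n.  A finite form of the Jacobi triple product
   gives P(q) = phi(q) / phi(-q^2) with phi(q) = sum_(k in Z) q^(k^2).  Put
   w = U P = phi(q^2) / phi(-q), u = w^2 - 1 and B = P^2 w.  Then P(-q) = 1/P(q)
   makes P quadratic over the series in q^2; P^4 = 1 + 2u; and u^2 lies in
   4 V(Z[u]) + 4 V(Z[u]) u, where V substitutes q^2 for q.  Hence U maps B Z[u]
   to itself with U B = B + 4 B u, and since U(B u) = 2 B u mod 4 B u Z[u] and
   U(B u^2 Z[u]) is in 4 B u Z[u], U multiplies B u (1 + 2 Z[u]) by 2.  For m odd,
   U^2 (P^m) is in B + 8 B u Z[u], so U^i (P^m) - U^(i-1) (P^m) is in
   2^(i-1) B u (1 + 2 Z[u]); finally u = 4z, where modulo 2 one has B = 1 and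
   z = sum_(k >= 0) q^((2k+1)^2). *)

From HB Require Import structures.
Require Import Defs.
From mathcomp Require Import all_boot all_order all_algebra.
From mathcomp Require Import boolp zify ring.

Set Implicit Arguments.
Unset Strict Implicit.
Unset Printing Implicit Defensive.

Import GRing.Theory.

Local Open Scope ring_scope.

(** * Integer power series in one variable q *)

Definition series : Type := nat -> int.

HB.instance Definition _ := gen_eqMixin series.
HB.instance Definition _ := gen_choiceMixin series.

Definition series_zero : series := fun=> 0.
Definition series_add (f g : series) : series := fun n => f n + g n.
Definition series_opp (f : series) : series := fun n => - f n.

Fact series_addA : associative series_add.
Proof. by move=> f g h; apply/funext => n; apply: addrA. Qed.

Fact series_addC : commutative series_add.
Proof. by move=> f g; apply/funext => n; apply: addrC. Qed.

Fact series_add0 : left_id series_zero series_add.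
Proof. by move=> f; apply/funext => n; apply: add0r. Qed.

Fact series_addN : left_inverse series_zero series_opp series_add.
Proof. by move=> f; apply/funext => n; apply: addNr. Qed.

HB.instance Definition _ :=
  GRing.isZmodule.Build series series_addA series_addC series_add0 series_addN.

Definition trunc (n : nat) (f : series) : {poly int} := \poly_(i < n) f i.

Definition series_one : series := fun n => (n == 0)%:R.
Definition series_mul (f g : series) : series :=
  fun n => \sum_(i < n.+1) f i * g (n - i)%N.

(** A coefficient of a product depends only on truncations of the factors, so commutativity and
    associativity can be read off from [{poly int}]. *)
Lemma coef_trunc_mul n k (f g : series) : (k < n)%N ->
  (trunc n f * trunc n g)`_k = series_mul f g k.
Proof.
move=> lt_kn; rewrite coefM; apply: eq_bigr => j _; rewrite !coef_poly.
by rewrite (leq_ltn_trans (leq_ord j)) // (leq_ltn_trans (leq_subr _ _)).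
Qed.

Lemma coefM_eq (p p' r : {poly int}) n :
  (forall k, (k <= n)%N -> p`_k = p'`_k) -> (p * r)`_n = (p' * r)`_n.
Proof.
by move=> eq_p; rewrite !coefM; apply: eq_bigr => j _; rewrite eq_p ?leq_ord.
Qed.

Lemma trunc_series_mul n k (f g : series) : (k < n)%N ->
  (trunc n (series_mul f g))`_k = (trunc n f * trunc n g)`_k.
Proof. by move=> lt_kn; rewrite coef_trunc_mul // coef_poly lt_kn. Qed.

Fact series_mulC : commutative series_mul.
Proof.
move=> f g; apply/funext => n.
by rewrite -!(coef_trunc_mul _ _ (ltnSn n)) mulrC.
Qed.

Fact series_mulA : associative series_mul.
Proof.
move=> f g h; apply/funext => n; rewrite [series_mul f _]series_mulC.
rewrite -!(coef_trunc_mul _ _ (ltnSn n)).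
rewrite (coefM_eq _ (p' := trunc n.+1 g * trunc n.+1 h)); last first.
  by move=> k le_kn; rewrite trunc_series_mul.
rewrite [RHS](coefM_eq _ (p' := trunc n.+1 f * trunc n.+1 g)); last first.
  by move=> k le_kn; rewrite trunc_series_mul.
by rewrite mulrC mulrA.
Qed.

Fact series_mul1 : left_id series_one series_mul.
Proof.
move=> f; apply/funext => n; rewrite /series_mul big_ord_recl /= mul1r subn0.
by rewrite big1 ?addr0 // => i _; rewrite mul0r.
Qed.

Fact series_mulDl : left_distributive series_mul +%R.
Proof.
move=> f g h; apply/funext => n; rewrite -[RHS]big_split.
by apply: eq_bigr => i _; apply: mulrDl.
Qed.

Fact series_oner_neq0 : series_one != 0.
Proof. by apply/eqP => /(congr1 (fun f : series => f 0%N)). Qed.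

HB.instance Definition _ := GRing.Zmodule_isComNzRing.Build series
  series_mulA series_mulC series_mul1 series_mulDl series_oner_neq0.

Lemma seriesP (f g : series) : (forall n, f n = g n) -> f = g.
Proof. exact: funext. Qed.

Lemma seriesD (f g : series) n : (f + g) n = f n + g n.
Proof. by []. Qed.

Lemma seriesN (f : series) n : (- f) n = - f n.
Proof. by []. Qed.

Lemma series1 n : (1 : series) n = (n == 0)%:R.
Proof. by []. Qed.

Lemma series0 n : (0 : series) n = 0.
Proof. by []. Qed.

Lemma seriesM (f g : series) n : (f * g) n = \sum_(i < n.+1) f i * g (n - i)%N.
Proof. by []. Qed.

Lemma seriesMn (f : series) k n : (f *+ k) n = f n *+ k.
Proof. by elim: k => // k IHk; rewrite !mulrS seriesD IHk. Qed.

Lemma series_sum I r (Q : pred I) (F : I -> series) n :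
  (\sum_(i <- r | Q i) F i) n = \sum_(i <- r | Q i) F i n.
Proof.
by elim/big_rec2: _ => // i x y _ <-; rewrite seriesD.
Qed.

(** Strong induction on the coefficient: as [f] has constant term 1, the last term of the
    convolution is [g n] itself. Quotients of series are handled by this cancellation, without
    forming inverses. *)
Lemma series_mulIr (f g h : series) : f 0%N = 1 -> g * f = h * f -> g = h.
Proof.
move=> f0 eq_gh; apply: seriesP => n; have [m] := ubnP n.
elim: m n => // m IHm n lt_nm.
have /(congr1 (fun f : series => f n)) := eq_gh.
rewrite !seriesM !big_ord_recr /= subnn f0 !mulr1.
rewrite (eq_bigr (fun i : 'I_n => h i * f (n - i)%N)) => [/addrI //|i _].
by rewrite IHm //; apply: leq_trans (ltn_ord i) _.
Qed.

(** Congruence modulo q^N. Infinite products are never formed: partial products are compared with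
    series up to this relation. *)
Definition eqmodX (N : nat) (f g : series) := forall n, (n < N)%N -> f n = g n.

Lemma eqmodX_refl N f : eqmodX N f f. Proof. by []. Qed.

Lemma eqmodX_sym N f g : eqmodX N f g -> eqmodX N g f.
Proof. by move=> eq_fg n /eq_fg. Qed.

Lemma eqmodX_trans N f g h : eqmodX N f g -> eqmodX N g h -> eqmodX N f h.
Proof. by move=> eq_fg eq_gh n lt_nN; rewrite eq_fg // eq_gh. Qed.

Lemma eqmodX_le M N f g : (M <= N)%N -> eqmodX N f g -> eqmodX M f g.
Proof. by move=> le_MN eq_fg n lt_nM; rewrite eq_fg // (leq_trans lt_nM). Qed.

Lemma eqmodX_eq f g : (forall N, eqmodX N f g) -> f = g.
Proof. by move=> eq_fg; apply: seriesP => n; apply: eq_fg (ltnSn n). Qed.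

Lemma eqmodXM N (f f' g g' : series) :
  eqmodX N f f' -> eqmodX N g g' -> eqmodX N (f * g) (f' * g').
Proof.
move=> eq_f eq_g n lt_nN; rewrite !seriesM; apply: eq_bigr => i _.
by rewrite eq_f ?eq_g //; have := ltn_ord i; lia.
Qed.

Lemma eqmodX_sum N I r (Q : pred I) (F G : I -> series) :
  (forall i, Q i -> eqmodX N (F i) (G i)) ->
  eqmodX N (\sum_(i <- r | Q i) F i) (\sum_(i <- r | Q i) G i).
Proof.
by move=> eq_FG n lt_nN; rewrite !series_sum; apply: eq_bigr => i Qi; apply: eq_FG.
Qed.

Lemma eqmodX_mulIr N (f g h : series) : f 0%N = 1 ->
  eqmodX N (g * f) (h * f) -> eqmodX N g h.
Proof.
move=> f0 eq_gh n; have [m] := ubnP n.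
elim: m n => // m IHm n lt_nm lt_nN.
have := eq_gh n lt_nN.
rewrite !seriesM !big_ord_recr /= subnn f0 !mulr1.
rewrite (eq_bigr (fun i : 'I_n => h i * f (n - i)%N)) => [/addrI //|i _].
have lt_in := ltn_ord i.
by rewrite IHm //; lia.
Qed.

Definition varq : series := fun n => (n == 1)%:R.

Lemma seriesXM (f : series) n : (varq * f) n = if n is n'.+1 then f n' else 0.
Proof.
rewrite seriesM; case: n => [|n]; first by rewrite big_ord1 mul0r.
rewrite 2!big_ord_recl big1 => [|i _]; last by rewrite mul0r.
by rewrite mul0r mul1r add0r addr0 subSS subn0.
Qed.

Lemma seriesXnM k (f : series) n :
  (varq ^+ k * f) n = if (k <= n)%N then f (n - k)%N else 0.
Proof.
elim: k n => [|k IHk] n; first by rewrite mul1r subn0.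
by rewrite exprS -mulrA seriesXM; case: n => // n; rewrite IHk ltnS subSS.
Qed.

Lemma seriesXn k n : (varq ^+ k) n = (n == k)%:R.
Proof. by rewrite -[_ ^+ _]mulr1 seriesXnM series1; case: leqP; lia. Qed.

Lemma eqmodX_Xn N k (f g : series) : eqmodX (N - k) f g ->
  eqmodX N (varq ^+ k * f) (varq ^+ k * g).
Proof.
move=> eq_fg n lt_nN; rewrite !seriesXnM; case: leqP => // le_kn.
by apply: eq_fg; lia.
Qed.

Lemma eqmodX_addXn N k (f g : series) : (N <= k)%N -> eqmodX N (f + varq ^+ k * g) f.
Proof.
move=> le_Nk n lt_nN; rewrite seriesD seriesXnM leqNgt.
by rewrite (leq_trans lt_nN) ?addr0.
Qed.

(** * The operators U and V and the sign change of q *)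

Definition opU (f : series) : series := fun n => f (2 * n)%N.
(* The substitution q := q^2. *)
Definition opV (f : series) : series :=
  fun n => if odd n then 0 else f n./2.
(* The substitution q := - q. *)
Definition altern (f : series) : series := fun n => (-1) ^+ n * f n.

Fact opU_is_additive : zmod_morphism opU. Proof. by []. Qed.
HB.instance Definition _ := GRing.isZmodMorphism.Build series series opU opU_is_additive.

Fact opV_is_additive : zmod_morphism opV.
Proof.
move=> f g; apply: seriesP => n; rewrite seriesD seriesN /opV.
by case: odd; rewrite ?subr0.
Qed.
HB.instance Definition _ := GRing.isZmodMorphism.Build series series opV opV_is_additive.

Fact altern_is_additive : zmod_morphism altern.
Proof. by move=> f g; apply: seriesP => n; rewrite seriesD seriesN /altern mulrBr. Qed.
HB.instance Definition _ := GRing.isZmodMorphism.Build series series altern altern_is_additive.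

Fact altern_is_monoid_morphism : monoid_morphism altern.
Proof.
split=> [|f g]; apply: seriesP => n.
  by rewrite /altern series1; case: n => [|n]; rewrite ?mulr0.
rewrite /altern !seriesM mulr_sumr; apply: eq_bigr => i _.
rewrite mulrACA -exprD subnKC //; exact: leq_ord.
Qed.
HB.instance Definition _ :=
  GRing.isMonoidMorphism.Build series series altern altern_is_monoid_morphism.

Lemma alternK f : altern (altern f) = f.
Proof. by apply: seriesP => n; rewrite /altern mulrA -expr2 sqrr_sign mul1r. Qed.

(** U is linear over the series in q^2: since [opV f] has only even exponents, only the even indices
    i = 2j of the convolution survive. *)
Lemma opUVM (f g : series) : opU (opV f * g) = f * opU g.
Proof.
apply: seriesP => n; rewrite /opU !seriesM.
rewrite (bigID (fun i : 'I_(2 * n).+1 => odd i)) /= big1 ?add0r; last first.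
  by move=> i i_odd; rewrite /opV i_odd mul0r.
have lt2 (i : 'I_n.+1) : (2 * i < (2 * n).+1)%N by have := ltn_ord i; lia.
have lth (j : 'I_(2 * n).+1) : (j./2 < n.+1)%N by have := ltn_ord j; lia.
rewrite (reindex_onto (fun i => Ordinal (lt2 i)) (fun j => Ordinal (lth j))) /=.
  apply: eq_big => [i|i _]; first by rewrite -val_eqE /=; lia.
  rewrite /opV oddM /= mul2n doubleK mul2n -!mul2n -mulnBr //.
move=> j j_even; apply: val_inj => /=; lia.
Qed.

Lemma opVK : cancel opV opU.
Proof.
by move=> f; apply: seriesP => n; rewrite /opU /opV oddM mul2n doubleK.
Qed.

Lemma opVU f : opV (opU f) *+ 2 = f + altern f.
Proof.
apply: seriesP => n; rewrite mulr2n !seriesD /opV /opU /altern -signr_odd.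
case: ifP => n_odd; first by rewrite addr0 mulN1r subrr.
by rewrite mul1r; congr (f _ + f _); lia.
Qed.

Lemma alternV f : altern (opV f) = opV f.
Proof.
apply: seriesP => n; rewrite /altern /opV -signr_odd.
by case: odd; rewrite ?mulr0 ?mul1r.
Qed.

(** At even indices this is [opUVM] with [opVK]; at an odd index n, one of i and n - i is odd, so
    every term vanishes. *)
Fact opV_is_monoid_morphism : monoid_morphism opV.
Proof.
split=> [|f g]; first by apply: seriesP => -[|[|n]]; rewrite /opV //= ; case: odd.
apply: seriesP => n; case n_odd: (odd n); last first.
  have -> : n = (2 * n./2)%N by lia.
  by rewrite -[RHS]/(opU _ _) opUVM opVK /opV oddM mul2n doubleK.
rewrite {1}/opV n_odd seriesM big1 // => i _; rewrite /opV.
case: ifP => [|i_odd]; first by rewrite mul0r.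
by rewrite oddB ?leq_ord // n_odd i_odd mulr0.
Qed.
HB.instance Definition _ :=
  GRing.isMonoidMorphism.Build series series opV opV_is_monoid_morphism.

Lemma opVX : opV varq = varq ^+ 2.
Proof.
apply: seriesP => n; rewrite seriesXn /opV /varq.
by move: n => [|[|[|[|n]]]] //=; case: ifP.
Qed.

Lemma alternX : altern varq = - varq.
Proof.
apply: seriesP => -[|[|n]]; rewrite /altern seriesN /varq /= ?mulr0 ?oppr0 //.
Qed.

Lemma altern_coef0 f : altern f 0%N = f 0%N. Proof. exact: mul1r. Qed.
Lemma opV_coef0 f : opV f 0%N = f 0%N. Proof. by []. Qed.
Lemma seriesM_coef0 (f g : series) : (f * g) 0%N = f 0%N * g 0%N.
Proof. by rewrite seriesM big_ord1. Qed.
Lemma seriesX_coef0 (f : series) k : f 0%N = 1 -> (f ^+ k) 0%N = 1.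
Proof. by move=> f0; elim: k => // k IHk; rewrite exprS seriesM_coef0 f0 IHk. Qed.

(** * The finite triple product *)

(** The Gaussian binomial coefficient, given by its Pascal rule so that no division is required. *)
Fixpoint qbin (R : comNzRingType) (q : R) (n m : nat) : R :=
  match n, m with
  | _, 0 => 1
  | 0, _.+1 => 0
  | n'.+1, m'.+1 => qbin q n' m' + q ^+ m * qbin q n' m
  end.

Definition qfact (R : comNzRingType) (q : R) (n : nat) : R :=
  \prod_(j < n) (1 - q ^+ j.+1).

Lemma qbinn0 (R : comNzRingType) (q : R) n : qbin q n 0 = 1.
Proof. by case: n. Qed.

Lemma qbinS (R : comNzRingType) (q : R) n m :
  qbin q n.+1 m.+1 = qbin q n m + q ^+ m.+1 * qbin q n m.+1.
Proof. by []. Qed.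

Lemma qbin_small (R : comNzRingType) (q : R) n m : (n < m)%N -> qbin q n m = 0.
Proof.
elim: n m => [|n IHn] [|m] //; rewrite ltnS => lt_nm.
by rewrite qbinS !IHn ?mulr0 ?addr0 // ltnW.
Qed.

Lemma qfactS (R : comNzRingType) (q : R) n :
  qfact q n.+1 = qfact q n * (1 - q ^+ n.+1).
Proof. exact: big_ord_recr. Qed.

(** Induction on m + k along the Pascal rule; the two terms combine through (1 - q^(m+1)) + q^(m+1)
    (1 - q^(k+1)) = 1 - q^(m+k+2). *)
Lemma qbin_fact (R : comNzRingType) (q : R) m k :
  qfact q m * qfact q k * qbin q (m + k) m = qfact q (m + k).
Proof.
have [n] := ubnP (m + k); elim: n m k => // n IHn [|m] k lt_mk_n.
  by rewrite qbinn0 mulr1 [X in X * _]big_ord0 mul1r.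
have IHm := IHn m k ltac:(lia).
rewrite addSn qbinS mulrDr qfactS.
have -> : qfact q m * (1 - q ^+ m.+1) * qfact q k * qbin q (m + k) m =
    (1 - q ^+ m.+1) * qfact q (m + k) by rewrite -IHm; ring.
case: k => [|k] in lt_mk_n IHm *.
  by rewrite addn0 qbin_small // qfactS; ring.
have IHk := IHn m.+1 k ltac:(lia).
rewrite -qfactS (qfactS q k) addnS -addSn.
have -> : qfact q m.+1 * (qfact q k * (1 - q ^+ k.+1)) *
     (q ^+ m.+1 * qbin q (m.+1 + k) m.+1) =
  q ^+ m.+1 * (1 - q ^+ k.+1) * (qfact q m.+1 * qfact q k * qbin q (m.+1 + k) m.+1) by ring.
by rewrite IHk (qfactS q (m.+1 + k)) -addnS exprD; ring.
Qed.

(** After the factor j = 0 is removed, the rest is the same product with x q in place of x. The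
    Pascal rule and C(j+1, 2) = C(j, 2) + j then match the terms. *)
Lemma qbinomial_theorem (R : comNzRingType) (q x y : R) n :
  \prod_(j < n) (y + x * q ^+ j) =
  \sum_(j < n.+1) q ^+ 'C(j, 2) * qbin q n j * x ^+ j * y ^+ (n - j).
Proof.
elim: n x => [|n IHn] x; first by rewrite big_ord0 big_ord1 !mulr1.
rewrite big_ord_recl mulr1 (eq_bigr (fun j : 'I_n => y + (x * q) * q ^+ j)); last first.
  by move=> j _; rewrite exprS mulrA.
rewrite IHn mulrDl [X in y * X]big_ord_recl mulrDr !mulr_sumr.
rewrite [RHS]big_ord_recl /= qbinn0 -!addrA; congr (_ + _).
  by rewrite !subn0 exprS; ring.
under [RHS]eq_bigr => j _.
  rewrite /bump /= add1n subSS mulrDr !mulrDl addrC; over.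
rewrite big_split; congr (_ + _).
  rewrite [RHS]big_ord_recr qbin_small //= !(mulr0, mul0r) addr0.
  apply: eq_bigr => j _; rewrite /bump /= add1n.
  have -> : (n - j = (n - j.+1).+1)%N by have := ltn_ord j; lia.
  by rewrite exprMn [y ^+ _.+1]exprS; ring.
by apply: eq_bigr => j _; rewrite binS bin1 exprD exprMn [x ^+ _.+1]exprS; ring.
Qed.

Definition Oprod (N : nat) : series := \prod_(j < N) (1 + varq ^+ (2 * j + 1)).
Definition Qprod (N : nat) : series := \prod_(j < N) (1 - varq ^+ (2 * j + 1)).
Definition Eprod (N : nat) : series := qfact (varq ^+ 2) N.

Lemma mulXnI k (f g : series) : varq ^+ k * f = varq ^+ k * g -> f = g.
Proof.
move=> eq_fg; apply: seriesP => n.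
have /(congr1 (fun f : series => f (n + k)%N)) := eq_fg.
by rewrite !seriesXnM leq_addl addnK.
Qed.

Lemma prod_X_even N : \prod_(j < N) varq ^+ (2 * j) = varq ^+ (N * (N - 1)).
Proof.
elim: N => [|N IHN]; first by rewrite big_ord0.
by rewrite big_ord_recr /= IHN -exprD; congr (_ ^+ _); nia.
Qed.

(** With N = M + 1 this is k(k-1) + (2N-1)(2N-k) = N(N-1) + N(2N-1) + (k-N)^2 over the integers; the
    truncated subtractions require the split at k = N. *)
Fact triple_exponent M k : (k <= 2 * M.+1)%N ->
  (k * (k - 1) + (2 * M.+1 - 1) * (2 * M.+1 - k) =
   M.+1 * (M.+1 - 1) + M.+1 * (2 * M.+1 - 1) + (k - M.+1 + (M.+1 - k)) ^ 2)%N.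
Proof.
move=> le_k; rewrite [(M.+1 - 1)%N]subn1 /= (_ : 2 * M.+1 - 1 = 2 * M + 1)%N; last by lia.
have [|/ltnW] := leqP k M.+1 => /subnKC.
  move: (_ - _)%N => d eM; have -> : (k - M.+1 + d = d)%N by lia.
  have -> : (2 * M.+1 - k = k + 2 * d)%N by lia.
  case: k eM {le_k} => [|k] eM; first by rewrite (_ : d = M.+1) // subn1; ring.
  by have -> : M = (k + d)%N; [lia | rewrite subSS subn0; ring].
move: (_ - _)%N => d ek; have -> : (d + (M.+1 - k) = d)%N by lia.
have -> : (2 * M.+1 - k = M.+1 - d)%N by lia.
have -> : (k * (k - 1) = (M.+1 + d) * (M + d))%N by rewrite -ek; congr muln; lia.
have: (d <= M.+1)%N by lia.
move=> /subnKC; move: (_ - _)%N => e; case: e => [|e] eM.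
  by rewrite (_ : d = M.+1) ?subn1 /=; [ring | lia].
by have -> : M = (d + e)%N; [lia | ring].
Qed.

(* The q-binomial theorem for (y, x, q) := (q^(2N-1), 1, q^2) and n = 2N.  The
   exponent [j - N + (N - j)], with truncated subtractions, is |j - N|. *)
Lemma finite_triple_product N :
  Oprod N ^+ 2 =
  \sum_(j < (2 * N).+1) varq ^+ ((j - N + (N - j)) ^ 2) * qbin (varq ^+ 2) (2 * N) j.
Proof.
case: N => [|M]; first by rewrite /Oprod big_ord0 big_ord1 mulr1 expr1n.
set N := M.+1.
(* Multiplying through avoids negative powers of q: among the 2N factors of the q-binomial product,
   the first N have q^(2j) taken out, for a total of q^(N(N-1)), and each of the last N has q^(2N-1)
   taken out. *)
apply: (@mulXnI (N * (N - 1) + N * (2 * N - 1))).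
transitivity (\prod_(j < 2 * N) (varq ^+ (2 * N - 1) + 1 * (varq ^+ 2) ^+ j)).
  rewrite -(big_mkord xpredT (fun j => varq ^+ (2 * N - 1) + 1 * (varq ^+ 2) ^+ j)).
  have e : (2 * N = N + N)%N by lia.
  rewrite [X in index_iota 0 X]e big_mkord big_split_ord /=.
  rewrite expr2 exprD mulrACA; congr (_ * _).
    rewrite -prod_X_even /Oprod (reindex_inj rev_ord_inj) -big_split.
    rewrite [in LHS](reindex_inj rev_ord_inj) /=.
    apply: eq_bigr => j _ /=; rewrite -exprM mul1r mulrDr mulr1 -exprD addrC.
    by congr (_ ^+ _ + _ ^+ _); have := ltn_ord j; lia.
  rewrite mulnC exprM -[X in _ ^+ X](card_ord N) -prodr_const -big_split /=.
  apply: eq_bigr => j _; rewrite -exprM mul1r mulrDr mulr1 -exprD.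
  by congr (_ + _ ^+ _); lia.
rewrite qbinomial_theorem mulr_sumr; apply: eq_bigr => j _.
rewrite expr1n mulr1 mulrAC -!exprM -exprD mulrA -exprD.
congr (_ ^+ _ * _); have : (2 * 'C(j, 2) = j * (j - 1))%N.
  by rewrite mul2n bin2 subn1 halfK oddM; case: (nat_of_ord j) => [|k] //=; lia.
by move=> ->; apply: triple_exponent; rewrite -ltnS.
Qed.

(** * Theta series *)

Definition squares : series := fun n => \sum_(k < n.+1) (n == k ^ 2)%N%:R.
(** The sum of q^(k^2) over all integers k: k and -k give the same square, and k = 0 is counted
    once. *)
Definition phi : series := squares *+ 2 - 1.
Definition theta : series := odd_square_coef.

Lemma squares_ub n N : (n <= N)%N -> squares n = \sum_(k < N.+1) (n == k ^ 2)%N%:R.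
Proof.
move=> le_nN; rewrite /squares (big_ord_widen N.+1 (fun k => (n == k ^ 2)%N%:R)) //.
rewrite [RHS](bigID (fun k : 'I_N.+1 => (k < n.+1)%N)) /=.
rewrite [X in _ + X]big1 ?addr0 // => k.
by rewrite -leqNgt => lt_nk; case: eqP => // e; exfalso; nia.
Qed.

Lemma squares_square k : squares (k ^ 2)%N = 1.
Proof.
have le_k : (k < (k ^ 2).+1)%N by nia.
rewrite /squares (bigD1 (Ordinal le_k)) //= eqxx big1 ?addr0 // => j /eqP ne_j.
case: eqP => // e; case: ne_j; apply: val_inj => /=; nia.
Qed.

Lemma squares_nonsquare n : (forall k, n != k ^ 2)%N -> squares n = 0.
Proof. by move=> nsq; rewrite /squares big1 // => k _; rewrite (negPf (nsq k)). Qed.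

Lemma thetaE n : theta n = \sum_(k < n.+1) (n == (2 * k + 1) ^ 2)%N%:R.
Proof.
rewrite /theta /odd_square_coef -[LHS]natz natr_sum.
by apply: eq_bigr => k _; rewrite eq_sym.
Qed.

Lemma theta_odd_square k : theta ((2 * k + 1) ^ 2)%N = 1.
Proof.
have le_k : (k < ((2 * k + 1) ^ 2).+1)%N by nia.
rewrite thetaE (bigD1 (Ordinal le_k)) //= eqxx big1 ?addr0 // => j /eqP ne_j.
case: eqP => // e; case: ne_j; apply: val_inj => /=; nia.
Qed.

Lemma theta_eq0 n : (forall k, n != (2 * k + 1) ^ 2)%N -> theta n = 0.
Proof. by move=> nsq; rewrite thetaE big1 // => k _; rewrite (negPf (nsq k)). Qed.

Lemma theta_mod4 n : (n %% 4 != 1)%N -> theta n = 0.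
Proof.
move=> n4; apply: theta_eq0 => k; apply: contraNneq n4 => ->.
by have -> : ((2 * k + 1) ^ 2 = (k ^ 2 + k) * 4 + 1)%N; [ring | rewrite modnMDl].
Qed.

Lemma opVVE f n : opV (opV f) n = if (4 %| n)%N then f (n %/ 4)%N else 0.
Proof.
rewrite /opV; case: (boolP (4 %| n)%N) => [/dvdnP[k ->]|n4].
  have -> : ((k * 4)./2 = k.*2)%N by lia.
  by rewrite oddM andbF odd_double doubleK mulnK.
case: ifP => // n_odd; case: ifP => // n2_odd.
by case/negP: n4; lia.
Qed.

(** Even squares are four times squares, and odd squares are 1 modulo 4, so the two summands have
    disjoint supports. *)
Lemma squares_dissection : squares = opV (opV squares) + theta.
Proof.
apply: seriesP => n; rewrite seriesD opVVE.
have [[k ->]|nsq] := pselect (exists k, n = k ^ 2)%N.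
  rewrite squares_square -(odd_double_half k); case: (odd k).
    have e : ((true + (k./2).*2) ^ 2 = (k./2 ^ 2 + k./2) * 4 + 1)%N.
      by rewrite /= -mul2n; ring.
    have -> : (4 %| (true + (k./2).*2) ^ 2 = false)%N by rewrite e; lia.
    by rewrite add0r addnC -mul2n theta_odd_square.
  have -> : ((false + (k./2).*2) ^ 2 = k./2 ^ 2 * 4)%N by rewrite /= add0n -mul2n; ring.
  by rewrite dvdn_mull // mulnK // squares_square theta_mod4 ?modnMl ?addr0.
rewrite squares_nonsquare => [|k]; last by apply: contra_notN nsq => /eqP ->; exists k.
rewrite theta_eq0 => [|k]; last by apply: contra_notN nsq => /eqP ->; eexists.
case: ifP => // /dvdnP[m en]; rewrite squares_nonsquare // => k.
apply: contra_notN nsq => /eqP; rewrite en mulnK // => ->; exists (2 * k)%N; ring.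
Qed.

Lemma phi_dissection : phi = opV (opV phi) + theta *+ 2.
Proof.
rewrite /phi {1}squares_dissection !(rmorphB, rmorphMn, rmorph1) /=.
by rewrite mulrnDl addrAC.
Qed.

(** Odd squares being 1 modulo 4, [theta] is q times a series in q^4; hence it is odd under q := -q
    and U kills it. *)
Lemma theta_dissection : theta = varq * opV (opV (fun n => theta (4 * n + 1)%N)).
Proof.
apply: seriesP => -[|n]; rewrite seriesXM; [exact: theta_mod4 | rewrite opVVE].
case: ifP => [/dvdnP[m ->]|n4]; first by rewrite mulnK // addn1 mulnC.
by rewrite theta_mod4 //; lia.
Qed.

Lemma altern_theta : altern theta = - theta.
Proof. by rewrite theta_dissection rmorphM /= alternV alternX mulNr. Qed.

Lemma altern_phi : altern phi = opV (opV phi) - theta *+ 2.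
Proof.
by rewrite {1}phi_dissection rmorphD rmorphMn /= altern_theta alternV mulNrn.
Qed.

Lemma opU_phi : opU phi = opV phi.
Proof.
rewrite {1}phi_dissection raddfD raddfMn /= opVK theta_dissection.
suff -> : opU (varq * opV (opV (fun n => theta (4 * n + 1)%N))) = 0 by rewrite addr0.
rewrite mulrC opUVM; suff -> : opU varq = 0 by rewrite mulr0.
by apply: seriesP => n; rewrite /opU /varq series0; case: eqP => //; lia.
Qed.

Lemma phi_coef0 : phi 0%N = 1.
Proof. by rewrite /phi seriesD seriesN seriesMn -[squares 0]/(squares (0 ^ 2)%N) squares_square. Qed.

Lemma altern_phi_coef0 : altern phi 0%N = 1.
Proof. by rewrite altern_coef0 phi_coef0. Qed.

(** * Product formulas for phi, as limits of the finite triple product *)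

Lemma prod_coef0 N (F : 'I_N -> series) :
  (forall i, F i 0%N = 1) -> (\prod_i F i) 0%N = 1.
Proof.
by move=> F0; elim/big_rec: _ => // i f _ f0; rewrite seriesM_coef0 F0 f0.
Qed.

Lemma Eprod_coef0 N : Eprod N 0%N = 1.
Proof.
by apply: prod_coef0 => i; rewrite -exprM seriesD seriesN seriesXn.
Qed.

Lemma Eprod_stable N k : eqmodX (2 * N + 2) (Eprod (N + k)) (Eprod N).
Proof.
elim: k => [|k IHk]; first by rewrite addn0.
apply: eqmodX_trans IHk; rewrite [(N + _.+1)%N]addnS /Eprod qfactS mulrDr mulr1 mulrN mulrC.
by rewrite -exprM -mulrN; apply: eqmodX_addXn; lia.
Qed.

(** With d = |j - N|, the numbers j and 2N - j are N - d and N + d in some order. The q-binomial is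
    thus [Eprod (2 * N)] over [Eprod (N - d)] times [Eprod (N + d)], and by [Eprod_stable] all
    [Eprod] involved agree to the stated order. *)
Lemma qbin_central N j : (j <= 2 * N)%N ->
  eqmodX (2 * (N - (j - N + (N - j))) + 2) (Eprod N * qbin (varq ^+ 2) (2 * N) j) 1.
Proof.
move=> le_j; set d := (j - N + (N - j))%N.
have := qbin_fact (varq ^+ 2) j (2 * N - j); rewrite subnKC // -!/(Eprod _) => fact.
apply: (eqmodX_mulIr (Eprod_coef0 (N + d))).
have -> : Eprod N * qbin (varq ^+ 2) (2 * N) j * Eprod (N + d) =
  Eprod N * (qbin (varq ^+ 2) (2 * N) j * Eprod (N + d)) by rewrite mulrA.
have E_eq M M' : (N - d <= M)%N -> (N - d <= M')%N ->
    eqmodX (2 * (N - d) + 2) (Eprod M) (Eprod M').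
  move=> /subnKC <- /subnKC <-.
  apply: (@eqmodX_trans _ _ (Eprod (N - d))); first exact: Eprod_stable.
  by apply: eqmodX_sym; apply: Eprod_stable.
have dN : (d <= N)%N by rewrite /d; lia.
rewrite mul1r; apply: (@eqmodX_trans _ _ (Eprod (2 * N))); last by apply: E_eq; lia.
rewrite -fact mulrCA [X in eqmodX _ X]mulrC.
apply: eqmodXM; last by [].
have [jN|/ltnW Nj] := leqP j N.
  have -> : (2 * N - j = N + d)%N by rewrite /d; lia.
  by rewrite mulrC; apply: eqmodXM => //; apply: E_eq; lia.
have -> : (j = N + d)%N by rewrite /d; lia.
by rewrite mulrC; apply: eqmodXM => //; apply: E_eq; lia.
Qed.

Lemma sum_Xsquares N :
  eqmodX N.+1 (\sum_(j < (2 * N).+1) varq ^+ ((j - N + (N - j)) ^ 2)) phi.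
Proof.
move=> n; rewrite ltnS => le_nN; rewrite series_sum.
rewrite -(big_mkord xpredT (fun j => (varq ^+ ((j - N + (N - j)) ^ 2)) n)).
rewrite (@big_cat_nat _ _ _ N) ?leq0n //=; last by lia.
have -> : phi n = (squares n - (n == 0)%:R) + squares n.
  by rewrite /phi seriesD seriesN seriesMn series1; ring.
(* The indices j < N stand for the negative integers j - N and give the nonzero squares; the others
   give all squares. *)
congr (_ + _).
  rewrite (squares_ub le_nN) big_ord_recl /= addrAC subrr add0r.
  rewrite big_mkord (reindex_inj rev_ord_inj); apply: eq_bigr => j _ /=.
  have lt_j := ltn_ord j; rewrite seriesXn /bump.
  by congr ((n == _)%N%:R); congr (_ ^ _)%N; lia.
rewrite (squares_ub le_nN) -{1}[N]add0n big_addn big_mkord.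
have -> : ((2 * N).+1 - N = N.+1)%N by lia.
apply: eq_bigr => j _; rewrite seriesXn; congr ((n == _)%N%:R); congr (_ ^ _)%N; lia.
Qed.

Lemma phi_product N : eqmodX N.+1 phi (Oprod N ^+ 2 * Eprod N).
Proof.
apply/eqmodX_sym/(eqmodX_trans _ (@sum_Xsquares N)).
rewrite finite_triple_product mulr_suml; apply: eqmodX_sum => j _.
rewrite -mulrA [X in eqmodX _ _ X](esym (mulr1 _)); apply: eqmodX_Xn.
rewrite mulrC; apply: eqmodX_le (qbin_central (leq_ord j)).
(* The precision suffices because d^2 + 2(N - d) + 2 = (d - 1)^2 + N + 1. *)
by move: (_ + _)%N => d; nia.
Qed.

Lemma eqmodX_altern N f g : eqmodX N f g -> eqmodX N (altern f) (altern g).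
Proof. by move=> eq_fg n lt_nN; rewrite /altern eq_fg. Qed.

Lemma eqmodX_opV N f g : eqmodX N f g -> eqmodX N (opV f) (opV g).
Proof. by move=> eq_fg n lt_nN; rewrite /opV eq_fg //; lia. Qed.

Lemma altern_Oprod N : altern (Oprod N) = Qprod N.
Proof.
rewrite /Oprod rmorph_prod; apply: eq_bigr => j _.
by rewrite rmorphD rmorph1 rmorphXn /= alternX exprNn -signr_odd oddD oddM expr1 mulN1r.
Qed.

Lemma altern_Eprod N : altern (Eprod N) = Eprod N.
Proof.
rewrite /Eprod /qfact rmorph_prod; apply: eq_bigr => j _.
by rewrite rmorphB rmorph1 !rmorphXn /= alternX sqrrN.
Qed.

Lemma altern_phi_product N : eqmodX N.+1 (altern phi) (Qprod N ^+ 2 * Eprod N).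
Proof.
have := eqmodX_altern (phi_product (N := N)).
by rewrite rmorphM rmorphXn /= altern_Oprod altern_Eprod.
Qed.

Lemma opV_Qprod N : opV (Qprod N) = Oprod N * Qprod N.
Proof.
rewrite /Oprod /Qprod -big_split rmorph_prod; apply: eq_bigr => j _ /=.
by rewrite rmorphB rmorph1 rmorphXn /= opVX exprAC; ring.
Qed.

(** The even exponents up to 4N split into the multiples of 4, from [Eprod], and those that are 2
    modulo 4, from [Qprod]. *)
Lemma opV_Eprod_Qprod N : opV (Eprod N * Qprod N) = Eprod (2 * N).
Proof.
elim: N => [|N IHN].
  by rewrite /Eprod /Qprod /qfact muln0 !big_ord0 mulr1 rmorph1.
rewrite /Eprod /Qprod qfactS big_ord_recr /= mulrACA rmorphM /= IHN.
rewrite mulnS !qfactS -mulrA; congr (_ * _); rewrite mulrC.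
rewrite rmorphM !rmorphB !rmorph1 !rmorphXn /= opVX.
by congr ((1 - _) * (1 - _)); rewrite -!exprM; congr (_ ^+ _); lia.
Qed.

Lemma opV_altern_phi_product N :
  eqmodX N.+1 (opV (altern phi)) (Oprod N * Qprod N * Eprod N).
Proof.
apply: eqmodX_trans (eqmodX_opV (altern_phi_product (N := N))) _.
have -> : Qprod N ^+ 2 * Eprod N = (Eprod N * Qprod N) * Qprod N by ring.
rewrite rmorphM /= opV_Eprod_Qprod opV_Qprod [X in eqmodX _ _ X]mulrC.
apply: eqmodXM => //; apply: (@eqmodX_le _ (2 * N + 2)); first lia.
by rewrite [Eprod (2 * N)](_ : _ = Eprod (N + N)); [apply: Eprod_stable | congr Eprod; lia].
Qed.

(** Up to any order, both sides are the product of the squares of [Oprod N], [Qprod N] and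
    [Eprod N]. *)
Lemma phi_altern_phi : phi * altern phi = opV (altern phi) ^+ 2.
Proof.
apply: eqmodX_eq => N; apply: (@eqmodX_le _ N.+1) => //.
apply: eqmodX_trans (eqmodXM (phi_product (N := N)) (altern_phi_product (N := N))) _.
rewrite expr2; apply: eqmodX_sym.
have := opV_altern_phi_product (N := N) => h; apply: eqmodX_trans (eqmodXM h h) _.
by move=> n _; congr ((_ : series) _); ring.
Qed.

Lemma phi_quotient (P : series) :
  (forall N, eqmodX N.+1 (P * Qprod N) (Oprod N)) -> P * opV (altern phi) = phi.
Proof.
move=> P_prod; apply: eqmodX_eq => N; apply: (@eqmodX_le _ N.+1) => //.
apply: eqmodX_trans (eqmodXM (@eqmodX_refl _ P) (opV_altern_phi_product (N := N))) _.
apply: eqmodX_trans (eqmodX_sym (phi_product (N := N))).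
have -> : P * (Oprod N * Qprod N * Eprod N) = P * Qprod N * (Oprod N * Eprod N).
  by ring.
by rewrite expr2 -(mulrA (Oprod N)); apply: eqmodXM; first exact: P_prod.
Qed.

(** * Counting overpartitions into odd parts *)

Definition odd_overpartition (n : nat) (s : seq (nat * bool)) : bool :=
  [&& overpartition s, odd_parts s & weight s == n].

Definition max_part_le (J : nat) (s : seq (nat * bool)) : bool :=
  all (leq^~ J) (unzip1 s).

Definition head_not (x : nat * bool) (s : seq (nat * bool)) : bool :=
  if s is y :: _ then y != x else true.

Definition restricted (J n : nat) (s : seq (nat * bool)) : bool :=
  odd_overpartition n s && max_part_le J s.

Lemma path_next_part_le x s : path next_part x s -> max_part_le x.1 s.
Proof.
elim: s x => //= y s IHs x /andP[/andP[le_yx _] /IHs le_s].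
rewrite /max_part_le /= le_yx; apply: sub_all le_s => z; lia.
Qed.

(** When no part exceeds J, a J can be put in front unless the list begins with an overlined J,
    which would cease to be a first occurrence. *)
Lemma path_next_part J b s : max_part_le J s ->
  path next_part (J, b) s = sorted next_part s && head_not (J, true) s.
Proof.
case: s => [|[c d] s] //= /andP[/= le_cJ _]; rewrite andbC /next_part /= le_cJ.
by rewrite xpair_eqE; case: eqP; case: d; rewrite ?andbT ?andbF.
Qed.

Lemma restricted_cons J n b s : odd J ->
  restricted J n ((J, b) :: s) =
  [&& (J <= n)%N, restricted J (n - J) s & head_not (J, true) s].
Proof.
move=> J_odd; rewrite /restricted /odd_overpartition /overpartition /odd_parts.
rewrite /max_part_le /weight /= J_odd leqnn (odd_gt0 J_odd) /=.
have -> : (J + sumn (unzip1 s) == n) = (J <= n)%N && (sumn (unzip1 s) == n - J)%N by lia.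
case: (boolP (max_part_le J s)) => [sJ|]; last by rewrite /max_part_le => /negPf ->; rewrite !andbF.
rewrite path_next_part // -/(max_part_le J s) sJ.
by case: (J <= n)%N; case: (sorted _ _); case: (head_not _ _); rewrite ?andbT ?andbF.
Qed.

(** The head bounds all parts, and it is odd; so either it is smaller than J, or J is even and
    cannot occur. *)
Lemma restricted_head J n a b s : (a < J)%N || ~~ odd J ->
  restricted J n ((a, b) :: s) = restricted J.-1 n ((a, b) :: s).
Proof.
rewrite /restricted => aJ; case: (boolP (odd_overpartition _ _)) => //=.
case/and3P => /andP[_ /path_next_part_le le_s] + _.
rewrite /max_part_le /odd_parts /= => /andP[a_odd _].
have [le_aJ|lt_Ja] := leqP a J.-1.
  rewrite (leq_trans le_aJ (leq_pred J)) /=.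
  by rewrite !(sub_all _ le_s) // => c /= le_ca; lia.
by have -> : (a <= J)%N = false by lia.
Qed.

(* Prepends copies of a non-overlined part J, at most [fuel] of them, to the lists
   enumerated by L.  An overlined J must come before them all, hence the two
   stages in [odd_overpartitions]. *)
Fixpoint insert_copies (L : nat -> seq (seq (nat * bool))) (J fuel n : nat) :=
  L n ++ if fuel is f.+1 then
           if (J <= n)%N then map (cons (J, false)) (insert_copies L J f (n - J))
           else [::]
         else [::].

Fixpoint odd_overpartitions (J n : nat) : seq (seq (nat * bool)) :=
  if J is J'.+1 then
    if odd J then
      let C n := insert_copies (odd_overpartitions J') J n n in
      C n ++ if (J <= n)%N then map (cons (J, true)) (C (n - J)%N) else [::]
    else odd_overpartitions J' n
  else if n == 0%N then [:: [::]] else [::].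

Lemma insert_copies_fuel L J f f' n : (0 < J)%N -> (n <= f)%N -> (n <= f')%N ->
  insert_copies L J f n = insert_copies L J f' n.
Proof.
move=> J0; elim: f f' n => [|f IHf] [|f'] n //= nf nf'.
- by case: leqP => //; lia.
- by case: leqP => //; lia.
by case: leqP => // le_Jn; rewrite (IHf f') //; lia.
Qed.

Section InsertCopies.

Context (L : nat -> seq (seq (nat * bool))) (J : nat).

Hypothesis J_odd : odd J.
Hypothesis mem_L : forall n s, (s \in L n) = restricted J.-1 n s.
Hypothesis uniq_L : forall n, uniq (L n).

Let J_gt0 : (0 < J)%N. Proof. exact: odd_gt0. Qed.

Lemma restricted_pred_head n b s : ((J, b) :: s \in L n) = false.
Proof.
rewrite mem_L /restricted /max_part_le /=.
by have -> : (J <= J.-1)%N = false; [lia | rewrite andbF].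
Qed.

Lemma mem_map_cons (x : nat * bool) s (l : seq (seq (nat * bool))) :
  (s \in map (cons x) l) = if s is y :: s' then (y == x) && (s' \in l) else false.
Proof.
case: s => [|y s']; first by apply/mapP => -[].
apply/mapP/andP => [[t tl [-> ->]]|[/eqP -> s'l]]; by [rewrite eqxx | exists s'].
Qed.

(** The lists obtained are those without an overlined J: as J is the largest size allowed, an
    overlined J could only stand at the head. *)
Lemma mem_insert_copies f n s : (n <= f)%N ->
  (s \in insert_copies L J f n) = restricted J n s && head_not (J, true) s.
Proof.
have le_pred n' a b s' : (a == J) = false ->
    restricted J n' ((a, b) :: s') = restricted J.-1 n' ((a, b) :: s').
  move=> aJ; have [lt_aJ|lt_Ja|/eqP] := ltngtP a J; last by rewrite aJ.
    by rewrite restricted_head ?lt_aJ.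
  rewrite /restricted /max_part_le /=.
  have [-> ->] : ((a <= J) = false)%N /\ ((a <= J.-1) = false)%N by split; lia.
  by [].
elim: f n s => [|f IHf] n s nf.
  rewrite [insert_copies _ _ _ _]cats0 mem_L; case: s => [|[a b] s]; first by rewrite andbT.
  have n0 : n = 0%N by lia.
  have none J' : restricted J' n ((a, b) :: s) = false.
    apply/negP; rewrite /restricted /odd_overpartition /overpartition /weight n0 /=.
    by case: a => [|a]; rewrite ?andbF // => /and3P[]; rewrite ?andbF.
  by rewrite !none.
rewrite /= mem_cat mem_L; case: leqP => [le_Jn|lt_nJ]; last first.
  rewrite orbF; case: s => [|[a b] s]; first by rewrite andbT.
  have [->|aJ] := eqVneq a J; last first.
    by rewrite (le_pred _ _ _ _ (negPf aJ)) /= xpair_eqE (negPf aJ) andbT.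
  by rewrite -mem_L restricted_pred_head restricted_cons // leqNgt lt_nJ.
rewrite mem_map_cons; case: s => [|[a b] s]; first by rewrite orbF andbT.
rewrite IHf; last by lia.
have [->|aJ] := eqVneq a J; last first.
  by rewrite (le_pred _ _ _ _ (negPf aJ)) /= !xpair_eqE (negPf aJ) andbT orbF.
rewrite -mem_L restricted_pred_head restricted_cons // le_Jn /= !xpair_eqE eqxx /=.
by case: b; rewrite ?andbF ?andbT.
Qed.

Lemma uniq_insert_copies f n : uniq (insert_copies L J f n).
Proof.
elim: f n => [|f IHf] n /=; first by rewrite cats0.
case: ifP => _; last by rewrite cats0.
rewrite cat_uniq uniq_L map_inj_uniq ?IHf ?andbT; last by move=> s t [].
by apply/hasPn => _ /mapP[s _ ->]; apply: negbT; apply: restricted_pred_head.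
Qed.

End InsertCopies.

Lemma odd_overpartitions_spec J :
  (forall n s, (s \in odd_overpartitions J n) = restricted J n s) /\
  (forall n, uniq (odd_overpartitions J n)).
Proof.
elim: J => [|J [mem_J uniq_J]].
  split=> [n s|n]; last by rewrite /=; case: ifP.
  rewrite /= /restricted /odd_overpartition /overpartition /max_part_le /weight.
  case: s => [|[a b] s]; first by rewrite /= andbT; case: n.
  case: eqP => _; rewrite ?inE /=; last by case: a => [|a]; rewrite ?andbF.
  by case: a => [|a]; rewrite ?andbF.
case J_odd : (odd J.+1); last first.
  split=> [n s|n]; rewrite /= -/(odd J.+1) J_odd // mem_J.
  case: s => [|[a b] s]; first by rewrite /restricted /max_part_le /= !andbT.
  by rewrite [RHS]restricted_head ?J_odd ?orbT.
have memC := mem_insert_copies J_odd mem_J.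
have uniqC := uniq_insert_copies J_odd mem_J uniq_J.
split=> [n s|n]; rewrite /= -/(odd J.+1) J_odd.
  rewrite mem_cat memC //; case: (leqP J.+1 n) => [le_Jn|lt_nJ].
    rewrite mem_map_cons; case: s => [|[a b] s]; first by rewrite orbF andbT.
    rewrite memC // [head_not _ (_ :: _)]/= xpair_eqE.
    case: eqP => [->|_]; last by rewrite andbT orbF.
    by rewrite restricted_cons // le_Jn; case: b; rewrite ?andbF ?andbT ?orbF.
  rewrite orbF; case: s => [|[a b] s]; first by rewrite andbT.
  rewrite /= xpair_eqE; case: eqP => [->|]; last by rewrite andbT.
  by rewrite restricted_cons // leqNgt lt_nJ.
rewrite cat_uniq uniqC; case: ifP => //= _.
rewrite map_inj_uniq ?uniqC ?andbT; last by move=> s t [].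
apply/hasPn => _ /mapP[s _ ->]; apply: negbT; apply: etrans (memC _ _ _ (leqnn _)) _ => /=.
by rewrite eqxx andbF.
Qed.

Definition bounded_count (N n : nat) : nat :=
  #|[set s : bounded_parts N | odd_overpartition n (parts_of s)]|.

Lemma parts_of_inj N : injective (@parts_of N).
Proof.
move=> s t; rewrite /parts_of => /inj_map eq_st; apply: val_inj; apply: eq_st.
by move=> [a b] [c d] /= [/val_inj -> ->].
Qed.

(** Links the cardinality of a finite type to an explicit enumeration by largest part; in particular
    the count does not depend on the bound [N] once [N] is at least [n]. *)
Lemma bounded_count_size J N n : (n <= J)%N -> (n <= N)%N ->
  bounded_count N n = size (odd_overpartitions J n).
Proof.
move=> nJ nN; rewrite /bounded_count cardE -(size_map (@parts_of N)).
apply/perm_size/uniq_perm => [||s].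
- by rewrite map_inj_uniq ?enum_uniq //; apply: parts_of_inj.
- exact: (odd_overpartitions_spec J).2.
rewrite (odd_overpartitions_spec J).1.
apply/mapP/andP => [[t + ->]|[odd_s _]].
  rewrite mem_enum inE => odd_t; split=> //.
  case/and3P: odd_t => _ _ /eqP; rewrite /weight /max_part_le.
  move=> e; rewrite -e in nJ; elim: (unzip1 _) nJ => //= a l IHl le_J.
  by apply/andP; split; [lia | apply: IHl; lia].
case/and3P: (odd_s) => over_s _ /eqP weight_s.
have [|t def_s] := overpartition_bounded over_s (n := N); first by rewrite weight_s.
by exists t; rewrite // mem_enum inE def_s.
Qed.

Definition overP : series := fun n => (bounded_count n n)%:R.

Definition boundedP (J : nat) : series := fun n => (size (odd_overpartitions J n))%:R.

Lemma eqmodX_overP J : eqmodX J.+1 overP (boundedP J).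
Proof. by move=> n lt_nJ; rewrite /overP (@bounded_count_size J). Qed.

Lemma boundedP0 : boundedP 0 = 1.
Proof. by apply: seriesP => -[|n]. Qed.

Lemma boundedP_even J : odd J -> boundedP J.+1 = boundedP J.
Proof. by move=> J_odd; apply: seriesP => n; rewrite /boundedP /= J_odd. Qed.

(** The series [C] counts the lists in which J+1 is never overlined. Removing one copy of J+1 gives
    the factor 1 - q^(J+1) for [C], and an optional overlined J+1 in front gives the factor 1 +
    q^(J+1). *)
Lemma boundedP_odd J : ~~ odd J ->
  boundedP J.+1 * (1 - varq ^+ J.+1) = boundedP J * (1 + varq ^+ J.+1).
Proof.
move=> J_odd.
pose C : series := fun n =>
  (size (insert_copies (odd_overpartitions J) J.+1 n n))%:R.
have eC : C * (1 - varq ^+ J.+1) = boundedP J.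
  apply: seriesP => n; rewrite mulrC mulrBl mul1r seriesD seriesN seriesXnM {1}/C.
  case: n => [|n]; first by rewrite /= cats0 subr0.
  rewrite /= size_cat ltnS subSS; case: leqP => le_Jn; last by rewrite addn0 subr0.
  rewrite size_map natrD (@insert_copies_fuel _ _ _ (n - J)) //; last exact: leq_subr.
  by rewrite addrK.
suff -> : boundedP J.+1 = C * (1 + varq ^+ J.+1) by rewrite -eC; ring.
apply: seriesP => n; rewrite mulrC mulrDl mul1r seriesD seriesXnM.
rewrite {1}/boundedP /= J_odd size_cat natrD; congr (_ + _).
by case: ifP => // _; rewrite size_map.
Qed.

Lemma boundedP_product N : boundedP (2 * N) * Qprod N = Oprod N.
Proof.
elim: N => [|N IHN].
  by rewrite /Qprod /Oprod !big_ord0 boundedP0 mulr1.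
have -> : (2 * N.+1 = (2 * N).+2)%N by lia.
rewrite boundedP_even /= ?oddM // /Qprod /Oprod !big_ord_recr /= -/(Qprod N) -/(Oprod N).
rewrite -IHN addn1 mulrCA boundedP_odd ?oddM //; ring.
Qed.

Lemma overP_product N : eqmodX N.+1 (overP * Qprod N) (Oprod N).
Proof.
rewrite -boundedP_product; apply: eqmodXM => //.
apply: (@eqmodX_le _ (2 * N).+1); first lia.
exact: eqmodX_overP.
Qed.

Lemma overP_phi : overP * opV (altern phi) = phi.
Proof. exact: phi_quotient overP_product. Qed.

(** * From overpartitions to m-tuples *)

Lemma sum_tupleS (R : comNzRingType) (T : finType) m (F : m.+1.-tuple T -> R) :
  \sum_t F t = \sum_s \sum_t F (cons_tuple s t).
Proof.
rewrite pair_big /= (reindex (fun p => cons_tuple p.1 p.2)) //.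
exists (fun t => (thead t, [tuple of behead t])) => [[s t]|t] _ /=.
  by congr (_, _); apply: val_inj.
by rewrite [RHS]tuple_eta.
Qed.

Lemma sum_tuple_prod (R : comNzRingType) (T : finType) m (G : T -> R) :
  \sum_(t : m.-tuple T) \prod_(s <- t) G s = (\sum_s G s) ^+ m.
Proof.
elim: m => [|m IHm].
  rewrite (bigD1 [tuple]) //= big_nil big1 ?addr0 // => t.
  by rewrite (tuple0 t) => /eqP[].
rewrite sum_tupleS exprS mulr_suml; apply: eq_bigr => s _.
by rewrite -IHm mulr_sumr; apply: eq_bigr => t _; rewrite big_cons.
Qed.

(** Modulo q^(n+1), [overP] is the finite sum of the monomials q^weight over the admissible bounded
    lists; its m-th power expands as a sum over m-tuples. *)
Lemma OPT_series m n : (OPT m n)%:R = (overP ^+ m) n.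
Proof.
pose G (s : bounded_parts n) : series :=
  if overpartition (parts_of s) && odd_parts (parts_of s)
  then varq ^+ weight (parts_of s) else 0.
have eq_P : eqmodX n.+1 overP (\sum_s G s).
  move=> k; rewrite ltnS => le_kn; rewrite series_sum.
  rewrite /overP (@bounded_count_size k) // -(@bounded_count_size k n) //.
  rewrite /bounded_count -sum1_card big_mkcond natr_sum; apply: eq_bigr => s _.
  rewrite inE /odd_overpartition andbA /G; case: (overpartition _ && _) => //=.
  by rewrite seriesXn eq_sym; case: eqP.
have eq_Pm : eqmodX n.+1 (overP ^+ m) (\sum_(t : m.-tuple (bounded_parts n)) \prod_(s <- t) G s).
  by rewrite sum_tuple_prod; elim: (m) => // k IHk; rewrite !exprS; apply: eqmodXM.
rewrite eq_Pm // series_sum /OPT -sum1_card big_mkcond natr_sum.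
apply: eq_bigr => t _; rewrite inE.
have -> : \prod_(s <- t) G s =
    if all (fun s => overpartition (parts_of s) && odd_parts (parts_of s)) t
    then varq ^+ (\sum_(s <- t) weight (parts_of s)) else 0.
  elim: (tval t) => [|s l IHl]; first by rewrite !big_nil.
  rewrite !big_cons IHl /= /G; case: ifP => _ /=; last by rewrite mul0r.
  by case: ifP => _; rewrite ?mulr0 // exprD.
case: (all _ _) => //=; rewrite seriesXn eq_sym; by case: eqP.
Qed.

Local Notation P := overP.

(** * Functional equations *)

Lemma mul2I (f g : series) : f *+ 2 = g *+ 2 -> f = g.
Proof.
move=> eq_fg; apply: seriesP => n.
have /(congr1 (fun f : series => f n)) := eq_fg; rewrite !seriesMn.
by lia.
Qed.

Lemma opV_altern_phi_coef0 : opV (altern phi) 0%N = 1.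
Proof. by rewrite opV_coef0 altern_phi_coef0. Qed.

Lemma overP_altern : P * altern P = 1.
Proof.
apply: (series_mulIr (seriesX_coef0 2 opV_altern_phi_coef0)).
have /(congr1 altern) := overP_phi; rewrite rmorphM /= alternV => eP.
have -> : P * altern P * opV (altern phi) ^+ 2 = (P * opV (altern phi)) * (altern P * opV (altern phi)).
  by ring.
by rewrite eP overP_phi phi_altern_phi mul1r.
Qed.

(** That is, P^2 = phi(q) / phi(-q), from P = phi(q) / phi(-q^2) and phi(q) phi(-q) =
    phi(-q^2)^2. *)
Lemma overP_sqr_phi : P ^+ 2 * altern phi = phi.
Proof.
apply: (series_mulIr phi_coef0).
by rewrite -mulrA [_ * phi]mulrC phi_altern_phi -exprMn overP_phi expr2.
Qed.

Definition w : series := opU P.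

Lemma w_phi : w * altern phi = opV phi.
Proof. by rewrite mulrC -opUVM mulrC overP_phi opU_phi. Qed.

(* phi(q) phi(-q) = phi(-q^2)^2 reads phi(q^4)^2 - 4 theta^2 = phi(-q^2)^2, whence
   phi(q^2)^2 - 4 U(theta^2) = phi(-q)^2; U(theta^2) is odd in q. *)
Lemma phi_sqrD : phi ^+ 2 + altern phi ^+ 2 = opV phi ^+ 2 *+ 2.
Proof.
have odd_part : altern (opU (theta ^+ 2)) = - opU (theta ^+ 2).
  rewrite theta_dissection exprMn -opVX -!rmorphXn -rmorphM /= opVK.
  by rewrite rmorphM /= alternX alternV mulNr.
have e : opV phi ^+ 2 - opU (theta ^+ 2) *+ 4 = altern phi ^+ 2.
  have /(congr1 opU) := phi_altern_phi; rewrite -rmorphXn /= opVK => <-.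
  rewrite altern_phi [X in opU (X * _)]phi_dissection.
  have -> : (opV (opV phi) + theta *+ 2) * (opV (opV phi) - theta *+ 2) =
    opV (opV phi) ^+ 2 - (theta ^+ 2) *+ 4 by ring.
  by rewrite (raddfB opU) raddfMn /= (expr2 (opV (opV phi))) opUVM opVK.
have /(congr1 altern) := e.
rewrite (rmorphB altern) (rmorphMn altern) !(rmorphXn altern) /= alternV alternK odd_part => <-.
rewrite -e; ring.
Qed.

Lemma overP_pow4 : P ^+ 4 = w ^+ 2 *+ 2 - 1.
Proof.
apply: (series_mulIr (seriesX_coef0 2 altern_phi_coef0)).
rewrite mulrBl mul1r mulrnAl -exprMn w_phi -phi_sqrD addrK.
by rewrite (exprM _ 2 2) -exprMn overP_sqr_phi.
Qed.

Lemma w_overP : w = P * opV P ^+ 2.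
Proof.
apply: (series_mulIr altern_phi_coef0); apply: (series_mulIr opV_altern_phi_coef0).
rewrite w_phi.
have -> : P * opV P ^+ 2 * altern phi * opV (altern phi) =
    P * opV (altern phi) * altern phi * opV P ^+ 2 by ring.
rewrite overP_phi.
have /(congr1 opV) := overP_sqr_phi; rewrite (rmorphM opV) (rmorphXn opV) /= => <-.
by rewrite phi_altern_phi; ring.
Qed.

(** P and P(-q) have product 1 and sum 2 V(w), twice the even part of P. *)
Lemma overP_quadratic : P ^+ 2 = opV w *+ 2 * P - 1.
Proof. by rewrite /w opVU mulrDl (mulrC (altern P)) overP_altern addrK. Qed.

Definition u : series := w ^+ 2 - 1.

Lemma overP_pow4_u : P ^+ 4 = 1 + u *+ 2.
Proof. by rewrite overP_pow4 /u; ring. Qed.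

(** If x + 1/x = c, then x^2 + 1/x^2 = c^2 - 2. *)
Lemma quadratic_sqr (R : comNzRingType) (x c : R) :
  x ^+ 2 = c * x - 1 -> x ^+ 4 = (c ^+ 2 - 2%:R) * x ^+ 2 - 1.
Proof.
move=> ex; have ecx : c * x = x ^+ 2 + 1 by rewrite ex subrK.
have -> : (c ^+ 2 - 2%:R) * x ^+ 2 - 1 = (c * x) ^+ 2 - x ^+ 2 *+ 2 - 1 by ring.
by rewrite ecx; ring.
Qed.

Lemma overP_pow4_quadratic : P ^+ 4 = opV (P ^+ 4) *+ 2 * P ^+ 2 - 1.
Proof.
rewrite [LHS](quadratic_sqr overP_quadratic) overP_pow4; congr (_ * _ - _).
by rewrite rmorphB rmorphMn rmorphXn rmorph1 /=; ring.
Qed.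

(** A second squaring gives P^8 = (4 V(P^8) - 2) P^4 - 1; putting P^4 = 1 + 2u makes everything
    divisible by 4, whence the two uses of [mul2I]. *)
Lemma u_quadratic : u ^+ 2 = opV (u + u ^+ 2) *+ 4 + opV (u + u ^+ 2) *+ 8 * u.
Proof.
do 2!apply: mul2I.
have := overP_pow4_quadratic; rewrite {1}(exprM _ 2 2) => /quadratic_sqr; rewrite -!exprM.
rewrite (exprM _ 4 2) overP_pow4_u => e8.
apply: (addIr (1 + u *+ 4)).
have -> : u ^+ 2 *+ 2 *+ 2 + (1 + u *+ 4) = (1 + u *+ 2) ^+ 2 by ring.
rewrite e8 !(rmorphD, rmorphMn, rmorphXn, rmorph1) /=; ring.
Qed.

(** * The action of U on polynomials in u *)

Definition in_Zu (f : series) : Prop := exists g : {poly int}, f = (map_poly intr g).[u].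

Lemma in_Zu_int (c : int) : in_Zu c%:~R.
Proof. by exists c%:P; rewrite map_polyC hornerC. Qed.

Lemma in_Zu_u : in_Zu u.
Proof. by exists 'X; rewrite map_polyX hornerX. Qed.

Lemma in_ZuD f g : in_Zu f -> in_Zu g -> in_Zu (f + g).
Proof. by move=> [p ->] [r ->]; exists (p + r); rewrite rmorphD hornerD. Qed.

Lemma in_ZuN f : in_Zu f -> in_Zu (- f).
Proof. by move=> [p ->]; exists (- p); rewrite rmorphN hornerN. Qed.

Lemma in_ZuM f g : in_Zu f -> in_Zu g -> in_Zu (f * g).
Proof. by move=> [p ->] [r ->]; exists (p * r); rewrite rmorphM hornerM. Qed.

Lemma in_Zu_nat n : in_Zu n%:R.
Proof. exact: (in_Zu_int n). Qed.

Lemma in_Zu1 : in_Zu 1. Proof. exact: (in_Zu_nat 1). Qed.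

Lemma in_ZuMn f n : in_Zu f -> in_Zu (f *+ n).
Proof. by rewrite -mulr_natr => Zf; apply: in_ZuM (in_Zu_nat n). Qed.

Lemma in_ZuX f n : in_Zu f -> in_Zu (f ^+ n).
Proof. by move=> Zf; elim: n => [|n Zfn]; [apply: in_Zu1 | rewrite exprS; apply: in_ZuM]. Qed.

Lemma in_Zu_ind (K : series -> Prop) :
  K 0 -> (forall f (c : int), in_Zu f -> K f -> K (f * u + c%:~R)) ->
  forall f, in_Zu f -> K f.
Proof.
move=> K0 KS f [g ->]; elim/poly_ind: g => [|g c IHg].
  by rewrite rmorph0 horner0.
rewrite rmorphD rmorphM /= map_polyX map_polyC hornerMXaddC.
by apply: KS IHg; exists g.
Qed.

Lemma in_Zu_case f : in_Zu f -> exists g (c : int), in_Zu g /\ f = g * u + c%:~R.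
Proof.
move: f; apply: in_Zu_ind => [|f c Zf _]; last by exists f, c.
by exists 0, 0; split; [apply: (in_Zu_nat 0) | rewrite mul0r addr0].
Qed.

Ltac Zu := repeat first
  [ assumption | apply: in_Zu_u | apply: in_Zu1 | apply: in_Zu_nat | apply: in_Zu_int
  | apply: in_ZuMn | apply: in_ZuX | apply: in_ZuD | apply: in_ZuN | apply: in_ZuM ].

Definition U_odd_power (n : nat) : series := opU (P ^+ (2 * n + 1)).

Lemma U_odd_power0 : U_odd_power 0 = w. Proof. by []. Qed.

Lemma U_odd_power1 : U_odd_power 1 = w * (1 + u *+ 4).
Proof.
have eP n : opU (P ^+ n.+2) = w *+ 2 * opU (P ^+ n.+1) - opU (P ^+ n).
  rewrite -addn2 exprD overP_quadratic mulrBr mulr1 raddfB /=; congr (_ - _).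
  by rewrite mulrCA -exprSr -rmorphMn opUVM.
have opU1 : opU 1 = 1 by rewrite -[1 in LHS](rmorph1 opV) opVK.
rewrite /U_odd_power !eP opU1 -/w /u; ring.
Qed.

(** U is applied to P^(2n+1) times the quadratic equation of P^2, whose coefficient 2 V(P^4) leaves
    U as 2 P^4 = 2 + 4u. *)
Lemma U_odd_powerS n :
  U_odd_power n.+2 = (2%:R + u *+ 4) * U_odd_power n.+1 - U_odd_power n.
Proof.
rewrite /U_odd_power.
have -> : (2 * n.+2 + 1 = 2 * n + 1 + 4)%N by lia.
rewrite exprD overP_pow4_quadratic mulrBr mulr1 raddfB /=; congr (_ - _).
rewrite mulrCA -exprD -rmorphMn /= opUVM overP_pow4_u.
have -> : (2 * n + 1 + 2 = 2 * n.+1 + 1)%N by lia.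
by ring.
Qed.

Lemma U_odd_power_form n : exists (a : int) h, in_Zu h /\
  U_odd_power n = w * (1 + a%:~R * u *+ 4 + u ^+ 2 * h *+ 16).
Proof.
(* The recurrence has order two, so two consecutive indices are carried along. *)
suff [] : (exists (a : int) h, in_Zu h /\
    U_odd_power n = w * (1 + a%:~R * u *+ 4 + u ^+ 2 * h *+ 16)) /\
  (exists (a : int) h, in_Zu h /\
    U_odd_power n.+1 = w * (1 + a%:~R * u *+ 4 + u ^+ 2 * h *+ 16)) by [].
elim: n => [|n [[b [h' [Zh' eb]]] [a [h [Zh ea]]]]].
  split; [exists 0, 0 | exists 1, 0]; (split; first exact: (in_Zu_nat 0)).
    by rewrite U_odd_power0 mulr0z; ring.
  by rewrite U_odd_power1 mulr1z; ring.
split; first by exists a, h.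
(* Coefficients of (2 + 4u) times the form with (a, h), minus the form with (b, h'): the term 4u *
   4au is what feeds [a] into the u^2 part. *)
exists (a *+ 2 + 1 - b), (a%:~R + h *+ 2 + u * h *+ 4 - h'); split; first by Zu.
by rewrite U_odd_powerS ea eb rmorphB rmorphD rmorphMn rmorph1 /=; ring.
Qed.

Definition B : series := P ^+ 2 * w.

(** As w = P V(P)^2, the argument is V(P^2) P^(2k+1). Small k yield U on w, w u, B and B u, since
    P^4 = 1 + 2u. *)
Lemma U_w_power k : opU (w * P ^+ (2 * k)) = P ^+ 2 * U_odd_power k.
Proof.
have -> : w * P ^+ (2 * k) = opV (P ^+ 2) * P ^+ (2 * k + 1).
  by rewrite w_overP (rmorphXn opV) addn1 [P ^+ (_ * _).+1]exprS /=; ring.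
exact: opUVM.
Qed.

Lemma U_w : opU w = B.
Proof. by have := U_w_power 0; rewrite mulr1. Qed.

Lemma U_w_u : opU (w * u) = B * (u *+ 6 + u ^+ 2 *+ 8).
Proof.
apply: mul2I; have := U_w_power 2; rewrite U_odd_powerS U_odd_power1 U_odd_power0.
rewrite overP_pow4_u mulrDr mulr1 (raddfD opU) /= U_w mulrnAr (raddfMn opU) /= => e.
apply: (addrI B); rewrite e /B; ring.
Qed.

Lemma U_B : opU B = B * (1 + u *+ 4).
Proof. by rewrite {1}/B mulrC (U_w_power 1) U_odd_power1 mulrA. Qed.

Lemma U_B_u : opU (B * u) = B * (u *+ 10 + u ^+ 2 *+ 40 + u ^+ 3 *+ 32).
Proof.
apply: mul2I; have := U_w_power 3; rewrite 2!U_odd_powerS U_odd_power1 U_odd_power0.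
have -> : w * P ^+ (2 * 3) = B * P ^+ 4 by rewrite /B; ring.
rewrite overP_pow4_u mulrDr mulr1 (raddfD opU) /= U_B mulrnAr (raddfMn opU) /= => e.
apply: (addrI (B * (1 + u *+ 4))); rewrite e /B; ring.
Qed.

(** The equation of u over the series in q^2 replaces u^2 inside U by a factor u + u^2 outside and a
    multiple of 4. *)
Lemma U_u_sqr f : opU (f * u ^+ 2) = (u + u ^+ 2) * (opU f *+ 4 + opU (f * u) *+ 8).
Proof.
have -> : f * u ^+ 2 = opV (u + u ^+ 2) * (f *+ 4 + f * u *+ 8).
  by rewrite [in LHS]u_quadratic; ring.
by rewrite opUVM (raddfD opU) /= !(raddfMn opU).
Qed.

Lemma U_int f (c : int) : opU (f * c%:~R) = opU f * c%:~R.
Proof. by rewrite !mulrzr raddfMz. Qed.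

(* By [U_u_sqr], it suffices to control U on f and f u. *)
Lemma U_in_BZu f : (exists2 k, in_Zu k & opU f = B * k) ->
  (exists2 k, in_Zu k & opU (f * u) = B * k) ->
  forall g, in_Zu g -> (exists2 k, in_Zu k & opU (f * g) = B * k) /\
    (exists2 k, in_Zu k & opU (f * u * g) = B * k).
Proof.
move=> [k0 Zk0 e0] [k1 Zk1 e1]; apply: in_Zu_ind => [|g c _ [[k Zk e] [k' Zk' e']]].
  by split; exists 0; rewrite ?mulr0 ?raddf0 //; apply: (in_Zu_nat 0).
split.
  exists (k' + k0 * c%:~R); first by Zu.
  rewrite mulrDr (raddfD opU) /= U_int e0 [g * u]mulrC [f * (_ * _)]mulrA e'; ring.
exists ((u + u ^+ 2) * (k *+ 4 + k' *+ 8) + k1 * c%:~R); first by Zu.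
rewrite mulrDr (raddfD opU) /= U_int e1.
have -> : f * u * (g * u) = f * g * u ^+ 2 by ring.
rewrite U_u_sqr e [f * g * u]mulrAC e'; ring.
Qed.

(** With g = p u + c, the constant contributes c U(B u), visibly in 2 B u Z[u], and p contributes
    U(B p u^2), where [U_u_sqr] supplies both the factor u and the evenness. *)
Lemma U_Bu_Zu g : in_Zu g -> exists2 k, in_Zu k & opU (B * u * g) = B * u * k *+ 2.
Proof.
move=> /in_Zu_case[p [c [Zp ->]]].
have [||[k Zk e] [k' Zk' e']] := @U_in_BZu B _ _ p Zp.
- by exists (1 + u *+ 4); [Zu | apply: U_B].
- by exists (u *+ 10 + u ^+ 2 *+ 40 + u ^+ 3 *+ 32); [Zu | apply: U_B_u].
exists ((1 + u) * (k *+ 2 + k' *+ 4) + (5%:R + u *+ 20 + u ^+ 2 *+ 16) * c%:~R); first by Zu.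
rewrite mulrDr (raddfD opU) /= U_int U_B_u.
have -> : B * u * (p * u) = B * p * u ^+ 2 by ring.
rewrite U_u_sqr e [B * p * u]mulrAC e'; ring.
Qed.

Lemma U_Bu_step g : in_Zu g -> exists2 k, in_Zu k &
  opU (B * u * (1 + g *+ 2)) = B * u * (1 + k *+ 2) *+ 2.
Proof.
(* U(B u) = 2 B u (5 + 20u + 16u^2), and 5 + 20u + 16u^2 = 1 + 2 (2 + 10u + 8u^2). *)
move=> /U_Bu_Zu[k Zk e]; exists (2%:R + u *+ 10 + u ^+ 2 *+ 8 + k); first by Zu.
rewrite mulrDr mulr1 (raddfD opU) /= U_B_u mulrnAr (raddfMn opU) /= e; ring.
Qed.

Lemma U2_odd_power n : exists2 g, in_Zu g & opU (U_odd_power n) = B + B * u * g *+ 8.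
Proof.
have [a [h [Zh ->]]] := U_odd_power_form n.
have [||[k Zk e] [k' Zk' e']] := @U_in_BZu w _ _ h Zh.
- by exists 1; [Zu | rewrite mulr1 U_w].
- by exists (u *+ 6 + u ^+ 2 *+ 8); [Zu | apply: U_w_u].
(* The first summand comes from 4a U(w u) = 8 a B u (3 + 4u), the second from 16 U(w h u^2) by
   [U_u_sqr]. *)
exists (a%:~R * (3%:R + u *+ 4) + (1 + u) * (k *+ 8 + k' *+ 16)); first by Zu.
have -> : w * (1 + a%:~R * u *+ 4 + u ^+ 2 * h *+ 16) =
  w + (w * u * a%:~R) *+ 4 + (w * h * u ^+ 2) *+ 16 by ring.
rewrite 2!(raddfD opU) /= !(raddfMn opU) /= U_int U_w U_w_u U_u_sqr e [w * h * u]mulrAC e'; ring.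
Qed.

Lemma U3_sub_U2 n : exists2 g, in_Zu g &
  opU (opU (U_odd_power n)) - opU (U_odd_power n) = B * u * (1 + g *+ 2) *+ 4.
Proof.
have [g Zg ->] := U2_odd_power n; have [k Zk e] := U_Bu_Zu Zg.
(* U B - B = 4 B u, and the correction terms 16 B u k - 8 B u g are multiples of 8 B u. *)
exists (k *+ 2 - g); first by Zu.
rewrite (raddfD opU) (raddfMn opU) /= U_B e; ring.
Qed.

Lemma iter_U_sub n j : exists2 g, in_Zu g &
  iter j opU (opU (opU (U_odd_power n)) - opU (U_odd_power n)) =
  B * u * (1 + g *+ 2) *+ 2 ^ (j + 2).
Proof.
elim: j => [|j [g Zg /= ->]]; first exact: U3_sub_U2.
rewrite (raddfMn opU) /=; have [k Zk ->] := U_Bu_step Zg.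
by exists k; rewrite // -mulrnA addSn expnS.
Qed.

Lemma iter_U_B j f g : iter j opU (f - g) = iter j opU f - iter j opU g.
Proof. by elim: j => //= j ->; rewrite raddfB. Qed.

Lemma iter_UE j f n : (iter j opU f) n = f (2 ^ j * n)%N.
Proof.
elim: j n => [|j IHj] n; first by rewrite mul1n.
by rewrite iterS {1}/opU IHj expnSr mulnA.
Qed.

(** * Reduction modulo 2 and the conclusion *)

Definition eqmod2 (f g : series) := exists h, f = g + h *+ 2.

Lemma eqmod2M f f' g g' : eqmod2 f f' -> eqmod2 g g' -> eqmod2 (f * g) (f' * g').
Proof.
move=> [h ->] [k ->]; exists (h * g' + f' * k + h * k *+ 2); ring.
Qed.

Lemma eqmod2_quotient f g h : g * f = h -> eqmod2 f 1 -> eqmod2 g h.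
Proof. by move=> <- [k ->]; exists (- (g * k)); ring. Qed.

Lemma eqmod2_phi : eqmod2 phi 1.
Proof. by exists (squares - 1); rewrite /phi; ring. Qed.

Lemma eqmod2_altern_phi : eqmod2 (altern phi) 1.
Proof.
have [h ->] := eqmod2_phi; exists (altern h).
by rewrite rmorphD rmorphMn rmorph1.
Qed.

Lemma eqmod2_opV_phi : eqmod2 (opV phi) 1.
Proof.
have [h ->] := eqmod2_phi; exists (opV h).
by rewrite rmorphD rmorphMn rmorph1.
Qed.

Lemma eqmod2_trans f g h : eqmod2 f g -> eqmod2 g h -> eqmod2 f h.
Proof. by move=> [k ->] [l ->]; exists (k + l); ring. Qed.

Lemma eqmod2_w : eqmod2 w 1.
Proof. exact: eqmod2_trans (eqmod2_quotient w_phi eqmod2_altern_phi) eqmod2_opV_phi. Qed.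

Lemma eqmod2_B : eqmod2 B 1.
Proof.
rewrite -[1]mulr1; apply: eqmod2M eqmod2_w.
exact: eqmod2_trans (eqmod2_quotient overP_sqr_phi eqmod2_altern_phi) eqmod2_phi.
Qed.

Lemma u_theta : exists2 z, u = z *+ 4 & eqmod2 z theta.
Proof.
have [w' ew] := eqmod2_w; pose z := w' + w' ^+ 2.
have uz : u = z *+ 4 by rewrite /u ew /z; ring.
exists z => //.
have ez : z * altern phi ^+ 2 = opV (opV phi) * theta.
  (* With a = V(V(phi)), 8 z phi(-q)^2 = phi(q)^2 - phi(-q)^2 = (a + 2 theta)^2 - (a - 2 theta)^2 =
     8 a theta. *)
  do 3!apply: mul2I.
  have -> : z * altern phi ^+ 2 *+ 2 *+ 2 *+ 2 = (z *+ 4 * altern phi ^+ 2) *+ 2 by ring.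
  rewrite -uz /u mulrBl mul1r -exprMn w_phi mulrnBl -phi_sqrD.
  rewrite altern_phi [X in X ^+ 2 + _]phi_dissection; ring.
apply: eqmod2_trans (eqmod2_quotient ez _) _.
  by rewrite -[1](expr1n _ 2) !expr2; apply: eqmod2M; apply: eqmod2_altern_phi.
rewrite -[X in eqmod2 _ X]mul1r; apply: eqmod2M; last by exists 0; rewrite mul0rn addr0.
by have [h ->] := eqmod2_opV_phi; exists (opV h); rewrite rmorphD rmorphMn rmorph1.
Qed.

Theorem theorem1p1 (m i : nat) (hm1 : (1 <= m)%N) (hm : odd m) (hi : (3 <= i)%N) :
  forall n : nat,
    ((OPT m (2 ^ i * n))%:Z - (OPT m (2 ^ (i - 1) * n))%:Z
       = 2 ^+ (i + 1) * odd_square_coef n %[mod 2 ^+ (i + 2)])%Z.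
Proof.
move=> n; rewrite -[(OPT _ _)%:Z]natz -[(OPT _ (2 ^ (i - 1) * n))%:Z]natz !OPT_series.
have -> : m = (2 * m./2 + 1)%N by lia.
(* The difference U^3 - U^2 is the base case, so i - 3 further applications of U reach U^i -
   U^(i-1). *)
have [g _ e] := iter_U_sub m./2 (i - 3).
have [z uz [h ez]] := u_theta.
have [k ek] : eqmod2 (B * z * (1 + g *+ 2)) theta.
  rewrite -[X in eqmod2 _ X]mul1r -[X in eqmod2 _ X]mulr1.
  apply: eqmod2M; last by exists g.
  by apply: eqmod2M; [apply: eqmod2_B | exists h].
(* The factor 2^(i-1) and u = 4z give 2^(i+1) B z (1 + 2g), where B z (1 + 2g) is [theta] modulo 2;
   the error is thus a multiple of 2^(i+2). *)
have -> : (overP ^+ (2 * m./2 + 1)) (2 ^ i * n)%N - (overP ^+ (2 * m./2 + 1)) (2 ^ (i - 1) * n)%N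
   = (theta *+ 2 ^ (i + 1) + k *+ 2 ^ (i + 2)) n.
  rewrite -!iter_UE -seriesN -seriesD; congr ((_ : series) _).
  have -> : iter i opU (overP ^+ (2 * m./2 + 1)) - iter (i - 1) opU (overP ^+ (2 * m./2 + 1)) =
      B * u * (1 + g *+ 2) *+ 2 ^ (i - 3 + 2).
    rewrite -e iter_U_B -[opU (opU (U_odd_power _))]/(iter 3 opU (P ^+ _)).
    rewrite -[opU (U_odd_power _)]/(iter 2 opU (P ^+ _)) -!iterD.
    by congr (iter _ _ _ - iter _ _ _); lia.
  have -> : (2 ^ (i + 2) = 2 * 2 ^ (i + 1))%N by rewrite -expnS addnS.
  rewrite uz [k *+ _]mulrnA -mulrnDl -ek.
  have -> : (2 ^ (i + 1) = 4 * 2 ^ (i - 3 + 2))%N.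
    by rewrite -(expnD 2 2); congr expn; lia.
  by rewrite !mulrnA; congr (_ *+ _); ring.
rewrite seriesD !seriesMn /theta -[_ *+ 2 ^ (i + 1)]mulr_natl.
by rewrite -[_ *+ 2 ^ (i + 2)]mulr_natr !natrX addrC modzMDl.
Qed.
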